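(* Let $p\in\mathbb{C}[z_1,\dots,z_d]$ have no zeros in $\mathbb{D}^d$, multidegree $n$, and vanish to order $M$ at $u=(1,\dots,1)$; write $p(u-\zeta)=\sum_{j\ge M}P_j(\zeta)$ and $\tilde p(u-\zeta)=\sum_{j\ge M}Q_j(\zeta)$ with $P_j,Q_j$ homogeneous of degree $j$. Suppose $f=\tilde p/p$ has non-tangential value $\nu$ at $u$. Then $f$ is non-tangentially $C^1$ at $u$ if and only if $P_M$ divides $Q_{M+1}-\nu P_{M+1}$. More generally, $f$ is non-tangentially $C^k$ at $u$ if and only if \[ F_1=\frac{Q_{M+1}-\nu P_{M+1}}{P_M},\quad F_2=\frac{Q_{M+2}-\nu P_{M+2}-F_1P_{M+1}}{P_M},\ \dots,\ F_k=\frac{Q_{M+k}-\nu P_{M+k}-\sum_{j=1}^{k-1}F_jP_{M+k-j}}{P_M} \] all belong to $\mathbb{C}[\zeta_1,\dots,\zeta_d]$ (each defined once the previous ones are polynomials). In this case $f(u-\zeta)-\big(\nu+\sum_{j=1}^kF_j(\zeta)\big)=o(r^k)$ as $\zeta\to0$ within any $AR_c$, where $r=|\zeta_1|$.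
   Context: $\mathbb{D}$ is the open unit disk; $RHP=\{\zeta\in\mathbb{C}:\mathrm{Re}\,\zeta>0\}$. $\tilde p(z)=z^n\overline{p(1/\bar z)}$ with $z^n=z_1^{n_1}\cdots z_d^{n_d}$. Vanishing to order $M$ at $u$ means the lowest nonzero homogeneous term of $\zeta\mapsto p(u-\zeta)$ has degree $M$. For $\zeta\in RHP^d$ let $D_\zeta=\{|\zeta_1|,\dots,|\zeta_d|,\mathrm{Re}\,\zeta_1,\dots,\mathrm{Re}\,\zeta_d\}$ and for $c>1$, $AR_c=\{\zeta\in RHP^d:1/c\le x/y\le c\ \forall x,y\in D_\zeta\}$. $f$ has non-tangential value $\nu$ at $u$ if $f(u-\zeta)\to\nu$ as $\zeta\to0$ in $AR_c$ for every $c>1$. $f$ is non-tangentially $C^k$ at $u$ if there is a polynomial $L$ of degree at most $k$ with $f(u-\zeta)-L(\zeta)=o(r^k)$, $r=|\zeta_1|$, as $\zeta\to0$ in $AR_c$, for every $c>1$. *)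

(* Defs.v *)
From mathcomp Require Import all_boot all_order all_algebra.
From mathcomp Require Import reals.
From mathcomp Require Import complex.
Import Order.TTheory GRing.Theory Num.Theory.
From mathcomp Require Import mpoly.

Set Implicit Arguments.
Unset Strict Implicit.
Unset Printing Implicit Defensive.

Local Open Scope ring_scope.

Definition cabs (R : realType) (z : R[i]) : R := complex.Re `|z|.

Definition in_polydisk (R : realType) (d : nat) (z : 'I_d -> R[i]) : Prop :=
  forall i, cabs (z i) < 1.

Definition in_RHP (R : realType) (d : nat) (zeta : 'I_d -> R[i]) : Prop :=
  forall i, 0 < complex.Re (zeta i).

Definition Dset (R : realType) (d : nat) (zeta : 'I_d -> R[i]) : seq R :=
  [seq cabs (zeta i) | i : 'I_d] ++ [seq complex.Re (zeta i) | i : 'I_d].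

Definition AR (R : realType) (d : nat) (c : R) (zeta : 'I_d -> R[i]) : Prop :=
  in_RHP zeta /\
  forall x y, x \in Dset zeta -> y \in Dset zeta -> c^-1 <= x / y <= c.

Definition u_minus (R : realType) (d : nat) (zeta : 'I_d -> R[i]) : 'I_d -> R[i] :=
  fun i => 1 - zeta i.

Definition nt_value (R : realType) (d : nat) (f : ('I_d -> R[i]) -> R[i]) (nu : R[i]) : Prop :=
  forall c : R, 1 < c -> forall eps : R, 0 < eps -> exists2 delta : R, 0 < delta &
    forall zeta, AR c zeta -> (forall i, cabs (zeta i) < delta) ->
      cabs (f (u_minus zeta) - nu) < eps.

Definition nt_approx (R : realType) (d : nat) (i1 : 'I_d) (f : ('I_d -> R[i]) -> R[i])
    (L : {mpoly R[i][d]}) (k : nat) : Prop :=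
  forall c : R, 1 < c -> forall eps : R, 0 < eps -> exists2 delta : R, 0 < delta &
    forall zeta, AR c zeta -> (forall i, cabs (zeta i) < delta) ->
      cabs (f (u_minus zeta) - L.@[zeta]) <= eps * (cabs (zeta i1)) ^+ k.

(* f is non-tangentially C^k at u: some polynomial L of degree at most k
   (msize = total degree + 1, and 0 for the zero polynomial) *)
Definition nt_Ck (R : realType) (d : nat) (i1 : 'I_d) (f : ('I_d -> R[i]) -> R[i])
    (k : nat) : Prop :=
  exists2 L : {mpoly R[i][d]}, (msize L <= k.+1)%N & nt_approx i1 f L k.

Definition hpart (R : realType) (d : nat) (j : nat) (p : {mpoly R[i][d]}) : {mpoly R[i][d]} :=
  \sum_(m <- msupp p | mdeg m == j) p@_m *: 'X_[m].

Definition shift (R : realType) (d : nat) (p : {mpoly R[i][d]}) : {mpoly R[i][d]} :=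
  p \mPo [tuple (1 - 'X_i) | i < d].

Definition multideg (R : realType) (d : nat) (p : {mpoly R[i][d]}) : 'X_{1..d} :=
  [multinom (\max_(m <- msupp p) m i)%N | i < d].

(* ptilde(z) = z^n conj(p(1/conj z)) = sum_m conj(a_m) z^(n - m) *)
Definition ptilde (R : realType) (d : nat) (p : {mpoly R[i][d]}) : {mpoly R[i][d]} :=
  \sum_(m <- msupp p) (conjc (p@_m)) *: 'X_[(multideg p - m)%MM].

Definition vanishes_to_order (R : realType) (d : nat) (p : {mpoly R[i][d]}) (M : nat) : Prop :=
  hpart M (shift p) != 0 /\ forall j, (j < M)%N -> hpart j (shift p) = 0.

Definition fratio (R : realType) (d : nat) (p : {mpoly R[i][d]}) : ('I_d -> R[i]) -> R[i] :=
  fun z => (ptilde p).@[z] / p.@[z].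

Definition Pj (R : realType) (d : nat) (p : {mpoly R[i][d]}) (j : nat) := hpart j (shift p).
Definition Qj (R : realType) (d : nat) (p : {mpoly R[i][d]}) (j : nat) := hpart j (shift (ptilde p)).

(* F_1, ..., F_k (given by F 1, ..., F k) are polynomials satisfying
   P_M F_j = Q_{M+j} - nu P_{M+j} - sum_{i=1}^{j-1} F_i P_{M+j-i}; since P_M != 0 and
   C[zeta] is a domain, this says exactly that each quotient F_j is a polynomial. *)
Definition F_seq_ok (R : realType) (d : nat) (p : {mpoly R[i][d]}) (M : nat) (nu : R[i])
    (k : nat) (F : nat -> {mpoly R[i][d]}) : Prop :=
  forall j, (1 <= j <= k)%N ->
    Pj p M * F j = Qj p (M + j) - nu%:MP * Pj p (M + j)
                   - \sum_(1 <= i < j) F i * Pj p (M + j - i).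

(* Main.v *)
(* For zeta in AR_c close to 0, join zeta to r v along a complex line, where v
   has positive coordinates and P_M(v) <> 0. The restriction of p(u - .) to this
   line is a polynomial of bounded degree without zeros in a disk of fixed radius
   around zeta, so its values at both ends are comparable (factor it into linear
   factors), and |p(u - zeta)| is bounded below by a multiple of r^M. As
   |p(u - zeta)| = O(r^M) too, f(u - zeta) - L(zeta) = o(r^k) in every AR_c if and
   only if ptilde(u - zeta) - L(zeta) p(u - zeta) = o(r^(M+k)), that is, if and
   only if the homogeneous parts of degree at most M + k of this polynomial
   vanish. Spelled out degree by degree, this is the recursion defining the F_j,
   which are then the homogeneous parts of L. *)
From HB Require Import structures.
Require Import Defs.
From mathcomp Require Import all_boot all_order all_algebra.
From mathcomp Require Import reals.
From mathcomp Require Import complex.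
Import Order.TTheory GRing.Theory Num.Theory.
From mathcomp Require Import mpoly.
From mathcomp Require Import ring lra.
Local Open Scope ring_scope.

Set Implicit Arguments.
Unset Strict Implicit.
Unset Printing Implicit Defensive.

(** * The real-valued modulus on the complex numbers *)

Section ComplexModulus.
Variable R : realType.
Implicit Types (x y z : R[i]) (t : R).

Lemma cabs_ge0 z : 0 <= cabs z.
Proof. by rewrite /cabs normc_def sqrtr_ge0. Qed.

Lemma cabsE z : (cabs z)%:C%C = `|z|.
Proof. by rewrite /cabs normc_def. Qed.

Lemma cabs0 : cabs (0 : R[i]) = 0.
Proof. by rewrite /cabs normr0. Qed.

Lemma cabs1 : cabs (1 : R[i]) = 1.
Proof. by rewrite /cabs normr1. Qed.

Lemma cabsM x y : cabs (x * y) = cabs x * cabs y.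
Proof. by apply: complexI; rewrite rmorphM /= !cabsE normrM. Qed.

Lemma cabsD x y : cabs (x + y) <= cabs x + cabs y.
Proof. by rewrite -lecR rmorphD /= !cabsE ler_normD. Qed.

Lemma cabsN x : cabs (- x) = cabs x.
Proof. by rewrite /cabs normrN. Qed.

Lemma cabsB x y : cabs (x - y) <= cabs x + cabs y.
Proof. by rewrite -(cabsN y); apply: cabsD. Qed.

Lemma cabs_real t : 0 <= t -> cabs (t%:C%C) = t.
Proof. by move=> t0; rewrite /cabs ger0_norm // lecR. Qed.

Lemma cabs_realM s t : 0 < s -> 0 < t -> cabs (s%:C%C * t%:C%C) = s * t.
Proof. by move=> s0 t0; rewrite -rmorphM cabs_real // mulr_ge0 ?ltW. Qed.

Lemma cabs_eq0 z : (cabs z == 0) = (z == 0).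
Proof. by rewrite -(inj_eq (@complexI R)) cabsE normr_eq0. Qed.

Lemma cabs_gt0 z : (0 < cabs z) = (z != 0).
Proof. by rewrite lt_def cabs_ge0 andbT cabs_eq0. Qed.

Lemma cabsX x n : cabs (x ^+ n) = cabs x ^+ n.
Proof. by elim: n => [|n IH]; rewrite ?expr0 ?cabs1 // !exprS cabsM IH. Qed.

Lemma cabs_prod I (r : seq I) (P : pred I) (F : I -> R[i]) :
  cabs (\prod_(i <- r | P i) F i) = \prod_(i <- r | P i) cabs (F i).
Proof. by apply: (big_morph _ cabsM cabs1). Qed.

Lemma cabs_sum I (r : seq I) (P : pred I) (F : I -> R[i]) :
  cabs (\sum_(i <- r | P i) F i) <= \sum_(i <- r | P i) cabs (F i).
Proof.
elim/big_ind2: _ => //; first by rewrite cabs0.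
by move=> a a' b b' ha hb; apply: le_trans (cabsD _ _) (lerD ha hb).
Qed.

Lemma sqr_cabs z : cabs z ^+ 2 = complex.Re z ^+ 2 + complex.Im z ^+ 2.
Proof. by rewrite /cabs normc_def /= sqr_sqrtr // addr_ge0 ?sqr_ge0. Qed.

Lemma Re_le_cabs z : complex.Re z <= cabs z.
Proof.
by apply: le_trans (ler_norm _) _; rewrite -lecR cabsE normc_ge_Re.
Qed.

Lemma Re_ge_opp_cabs z : - cabs z <= complex.Re z.
Proof.
rewrite lerNl -cabsN; case: z => a b.
exact: (Re_le_cabs (- (a +i* b)%C)).
Qed.

Lemma ReD x y : complex.Re (x + y) = complex.Re x + complex.Re y.
Proof. by case: x y => [a b] [a' b']. Qed.

(** Expand [|1 - z|^2 = 1 - 2 Re z + |z|^2]. *)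
Lemma cabs_1B_lt1 z : cabs z ^+ 2 < 2 * complex.Re z -> cabs (1 - z) < 1.
Proof.
move=> h; rewrite -(@ltr_pXn2r _ 2) ?nnegrE ?cabs_ge0 // expr1n sqr_cabs.
by move: h; rewrite sqr_cabs; case: z => a b /= h; nra.
Qed.

End ComplexModulus.

(** * Growth and vanishing of polynomials in one variable *)

Section UnivariatePolynomials.
Variable R : realType.
Implicit Types (q : {poly R[i]}).

(** Every root [z] has [|z| >= rho], hence [|1 - z| <= 1 + |z| <= |z| (1 + 1/rho)]. Each of the at
    most [N] linear factors therefore grows by at most [1 + 1/rho] between 0 and 1. *)
Lemma horner1_le_horner0 q N (rho : R) : 0 < rho -> (size q <= N.+1)%N ->
    (forall w, cabs w < rho -> q.[w] != 0) ->
  cabs q.[1] <= cabs q.[0] * (1 + rho^-1) ^+ N.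
Proof.
move=> rho0 szq nz; have [r qE] := closed_field_poly_normal q.
have q0 : q != 0 by apply: contraTneq (nz 0 _) => [->|]; rewrite ?horner0 ?eqxx ?cabs0.
have szr : (size r <= N)%N.
  by move: szq; rewrite {1}qE size_scale ?lead_coef_eq0 // size_prod_XsubC.
have rr z : z \in r -> rho <= cabs z.
  move=> zr; rewrite leNgt; apply/negP => /nz /negP; apply.
  by rewrite qE hornerZ mulf_eq0 -!rootE root_prod_XsubC zr orbT.
have ev w : cabs q.[w] = cabs (lead_coef q) * \prod_(z <- r) cabs (w - z).
  rewrite {1}qE hornerZ cabsM horner_prod cabs_prod.
  by congr (_ * _); apply: eq_bigr => z _; rewrite hornerXsubC.
rewrite !ev -mulrA ler_wpM2l ?cabs_ge0 //.
have rho1 : 1 <= 1 + rho^-1 by rewrite lerDl invr_ge0 ltW.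
apply: (@le_trans _ _ (\prod_(z <- r) cabs (0 - z) * (1 + rho^-1) ^+ size r)); last first.
  by rewrite ler_wpM2l ?prodr_ge0 // => [z _|]; rewrite ?cabs_ge0 ?ler_weXn2l.
have -> : (1 + rho^-1) ^+ size r = \prod_(z <- r) (1 + rho^-1).
  by rewrite big_const_seq count_predT iter_mulr_1.
rewrite -big_split big_seq [leRHS]big_seq /=; apply: ler_prod => z /rr hz.
rewrite cabs_ge0 /= sub0r cabsN mulrDr mulr1.
apply: le_trans (cabsB _ _) _; rewrite cabs1 addrC lerD2l.
by rewrite ler_pdivlMr ?mul1r.
Qed.

(** The sample points are positive, so that a positive coordinate scaled by one of them stays
    positive. *)
Lemma poly_natS_eq0 q : (forall n : nat, q.[n.+1%:R] = 0) -> q = 0.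
Proof.
move=> q0; apply: (@roots_geq_poly_eq0 _ _ [seq n.+1%:R | n <- iota 0 (size q)]).
- by apply/allP => _ /mapP[n _ ->]; rewrite rootE q0.
- rewrite map_inj_uniq ?iota_uniq // => a b /eqP.
  by rewrite eqr_nat => /eqP [].
- by rewrite size_map size_iota.
Qed.

(** Peel off the constant term: a small enough [t] forces it to be 0, and dividing by [t] lowers
    both the degree and [m] by one. *)
Lemma horner_littleo_coef_eq0 q m :
    (forall eps : R, 0 < eps -> exists2 delta : R, 0 < delta &
      forall t : R, 0 < t < delta -> cabs q.[t%:C%C] <= eps * t ^+ m) ->
  forall j, (j <= m)%N -> q`_j = 0.
Proof.
elim/poly_ind: q m => [|q c IH] m ho j jm; first by rewrite coef0.
pose K := \sum_(i < size q) cabs q`_i.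
have K0 : 0 <= K by apply: sumr_ge0 => i _; apply: cabs_ge0.
have qK t : 0 < t < 1 -> cabs q.[t%:C%C] <= K.
  move=> /andP[t0 t1]; rewrite horner_coef; apply: le_trans (cabs_sum _ _ _) _.
  apply: ler_sum => i _; rewrite cabsM cabsX cabs_real ?(ltW t0) //.
  by rewrite ler_piMr ?cabs_ge0 // exprn_ile1 ?ltW.
have c0 : c = 0.
  apply/eqP; rewrite -cabs_eq0 -[_ == _]negbK; apply/negP => cn.
  have cp : 0 < cabs c by rewrite lt_def cn cabs_ge0.
  have [del del0 hdel] := ho (cabs c / 3) ltac:(by rewrite divr_gt0).
  (* The three bounds give [t < 1], [t < del] and [|q(t) t| <= |c| / 3]. With
     [|q(t) t + c| <= |c| / 3] this yields [|c| <= 2 |c| / 3], which is absurd. *)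
  pose t := Num.min (Num.min 2^-1 (del / 2)) (cabs c / (3 * (K + 1))).
  have t0 : 0 < t by rewrite !lt_min invr_gt0 !divr_gt0 ?mulr_gt0 ?ltr0n // ltr_wpDl.
  have t1 : t < 1 by rewrite !gt_min; apply/orP; left; apply/orP; left; lra.
  have td : t < del by rewrite !gt_min; apply/orP; left; apply/orP; right; lra.
  have tK : t * (K + 1) <= cabs c / 3.
    have: t <= cabs c / (3 * (K + 1)) by rewrite ge_min lexx orbT.
    by rewrite invfM mulrA ler_pdivlMr // ltr_wpDl.
  have := hdel t; rewrite t0 td => /(_ isT).
  rewrite hornerMXaddC => h1.
  have h2 : cabs c / 3 * t ^+ m <= cabs c / 3.
    by rewrite ler_piMr ?divr_ge0 ?cabs_ge0 // exprn_ile1 ?ltW.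
  have h3 : cabs (q.[t%:C%C] * t%:C%C) <= K * t.
    by rewrite cabsM cabs_real ?(ltW t0) // ler_wpM2r ?(ltW t0) // qK ?t0.
  have h4 : cabs c <= cabs (q.[t%:C%C] * t%:C%C + c) + cabs (q.[t%:C%C] * t%:C%C).
    by rewrite -{1}(addKr (q.[t%:C%C] * t%:C%C) c) addrC cabsB.
  nra.
rewrite c0 addr0 coefMX; case: j jm => //= j; case: m ho => // m ho jm.
apply: (IH m) => // eps eps0; have [del del0 hdel] := ho eps eps0.
exists del => // t /andP[t0 td]; move: (hdel t); rewrite t0 td => /(_ isT).
rewrite c0 addr0 hornerMX cabsM cabs_real ?(ltW t0) // exprSr mulrA.
by rewrite ler_pM2r.
Qed.

End UnivariatePolynomials.

(** * Homogeneous parts, restriction to lines, and vanishing on positive points *)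

Section HomogeneousParts.
Variables (R : realType) (d : nat).
Implicit Types (p q G : {mpoly R[i][d]}) (z v : 'I_d -> R[i]) (m : 'X_{1..d}).

(* p(tX), as a polynomial in t: being a ring morphism in p, it turns
   the homogeneous parts of a product into polynomial coefficients. *)
Definition hgen p : {poly {mpoly R[i][d]}} :=
  mmap (polyC \o @mpolyC d R[i]) (fun i => 'X_i *: 'X) p.

HB.instance Definition _ := GRing.RMorphism.copy hgen hgen.

Lemma coef_hgen p j : (hgen p)`_j = hpart j p.
Proof.
rewrite /hgen /mmap coef_sum /hpart [RHS]big_mkcond; apply: eq_bigr => m _.
rewrite /= coefCM /mmap1 (eq_bigr (fun i => 'X_i ^+ m i *: 'X^(m i))); last first.
  by move=> i _; rewrite exprZn.
rewrite scaler_prod -mpolyXE_id prodrXr -mdegE coefZ coefXn mul_mpolyC.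
by rewrite eq_sym; case: eqP => _; rewrite ?mulr1 ?mulr0 ?scaler0.
Qed.

Lemma hpartD j p q : hpart j (p + q) = hpart j p + hpart j q.
Proof. by rewrite -!coef_hgen (rmorphD hgen) coefD. Qed.

Lemma hpartB j p q : hpart j (p - q) = hpart j p - hpart j q.
Proof. by rewrite -!coef_hgen (rmorphB hgen) coefB. Qed.

Lemma hpart_sum j I (r : seq I) (P : pred I) (F : I -> {mpoly R[i][d]}) :
  hpart j (\sum_(i <- r | P i) F i) = \sum_(i <- r | P i) hpart j (F i).
Proof.
rewrite -coef_hgen (rmorph_sum hgen) coef_sum.
by apply: eq_bigr => i _; rewrite coef_hgen.
Qed.

Lemma hpartM j p q : hpart j (p * q) = \sum_(i < j.+1) hpart i p * hpart (j - i) q.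
Proof.
rewrite -coef_hgen (rmorphM hgen p q) coefM.
by apply: eq_bigr => i _; congr (_ * _); apply: coef_hgen.
Qed.

Lemma hpartC j (c : R[i]) : hpart j c%:MP_[d] = if j == 0%N then c%:MP else 0.
Proof. by rewrite -coef_hgen /hgen mmapC coefC. Qed.

Lemma mcoeff_hpart j p m : (hpart j p)@_m = if mdeg m == j then p@_m else 0.
Proof.
rewrite /hpart raddf_sum /= big_mkcond.
have [mp|mp] := boolP (m \in msupp p).
  rewrite (bigD1_seq m) ?msupp_uniq //= big1 ?addr0 => [|k km].
    by case: ifP => _; rewrite ?mcoeff0 // mcoeffZ mcoeffX eqxx mulr1.
  by case: ifP => _; rewrite ?mcoeff0 // mcoeffZ mcoeffX (negPf km) mulr0.
rewrite (memN_msupp_eq0 mp) if_same big_seq big1 // => k kp.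
case: ifP => // _; rewrite mcoeffZ mcoeffX; case: eqP => [km|]; last by rewrite mulr0.
by rewrite -km kp in mp.
Qed.

Lemma hpart_hpart i j p : hpart i (hpart j p) = if i == j then hpart j p else 0.
Proof.
apply/mpolyP => m; rewrite mcoeff_hpart; have [->|ij] := eqVneq i j.
  by rewrite mcoeff_hpart; case: (mdeg m == j).
rewrite mcoeff_hpart mcoeff0; case: eqP => // ->.
by rewrite (negPf ij).
Qed.

(** The restriction [t -> p(t z)] of [p] to the line through 0 and [z]. *)
Definition ray_poly z p : {poly R[i]} := map_poly (meval z) (hgen p).

Lemma coef_ray_poly z p j : (ray_poly z p)`_j = (hpart j p).@[z].
Proof. by rewrite coef_map coef_hgen. Qed.

Lemma horner_ray_poly z p t : (ray_poly z p).[t] = p.@[fun i => t * z i].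
Proof.
rewrite /ray_poly /hgen /mmap rmorph_sum horner_sum mevalE.
apply: eq_bigr => m _; rewrite rmorphM /= map_polyC hornerM hornerC /= mevalC.
congr (_ * _); rewrite /mmap1 rmorph_prod horner_prod; apply: eq_bigr => i _.
by rewrite rmorphXn horner_exp /= map_polyZ map_polyX hornerZ hornerX /= mevalXU mulrC.
Qed.

Lemma meval_hpart_scale j p (t : R[i]) z :
  (hpart j p).@[fun i => t * z i] = t ^+ j * (hpart j p).@[z].
Proof.
rewrite -horner_ray_poly; have -> : ray_poly z (hpart j p) = (hpart j p).@[z] *: 'X^j.
  apply/polyP => i; rewrite coef_ray_poly coefZ coefXn hpart_hpart.
  by case: eqP => _; rewrite ?mulr1 ?mulr0 ?meval0.
by rewrite hornerZ hornerXn mulrC.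
Qed.

(** Only monomials of degree at least [n] occur in [G], and [r <= 1] bounds each of them by
    [r ^+ n]. The summand 1 in the constant keeps it positive when [G] is 0. *)
Lemma meval_le_of_hpart_eq0 G n : (forall j, (j < n)%N -> hpart j G = 0) ->
  exists2 C : R, 0 < C & forall z (r : R), 0 <= r <= 1 ->
    (forall i, cabs (z i) <= r) -> cabs G.@[z] <= C * r ^+ n.
Proof.
move=> G0; exists (1 + \sum_(m <- msupp G) cabs G@_m).
  by rewrite ltr_wpDr // sumr_ge0 // => *; apply: cabs_ge0.
move=> z r /andP[r0 r1] zr; rewrite mevalE; apply: le_trans (cabs_sum _ _ _) _.
rewrite mulrDl mul1r mulr_suml ler_wpDl ?exprn_ge0 // big_seq [leRHS]big_seq.
apply: ler_sum => m mG; rewrite cabsM ler_wpM2l ?cabs_ge0 // cabs_prod.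
have nm : (n <= mdeg m)%N.
  rewrite leqNgt; apply/negP => /G0 /(congr1 (mcoeff m)).
  rewrite mcoeff_hpart eqxx mcoeff0 => /eqP.
  by rewrite mcoeff_eq0 mG.
apply: (@le_trans _ _ (r ^+ mdeg m)); last exact: ler_wiXn2l.
rewrite mdegE -prodrXr; apply: ler_prod => i _.
rewrite cabs_ge0 cabsX andTb lerXn2r ?nnegrE ?cabs_ge0 //.
Qed.

(** Positive real points are the ones at hand: the ray through such a point stays in one [AR c]. *)
Lemma mpoly_eq0_of_posreal G :
    (forall v : 'I_d -> R, (forall i, 0 < v i) -> G.@[fun i => (v i)%:C%C] = 0) ->
  G = 0.
Proof.
move=> G0; apply/mpolyP => k; rewrite mcoeff0.
(* One coordinate at a time, separate the monomials by their degree in it. *)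
have step (s : seq 'I_d) (v : 'I_d -> R) : (forall i, 0 < v i) ->
  \sum_(m <- msupp G | all (fun i => m i == k i) s)
     G@_m * \prod_i (v i)%:C%C ^+ m i = 0.
  elim: s v => [|j s IH] v v0 /=; first by rewrite -mevalE G0.
  (* The variable of [q] scales the coordinate [j] of [v]. The induction hypothesis at the scaled
     points makes [q] vanish at all positive integers, and its coefficient of index [k j] is the sum
     sought. *)
  pose q := \sum_(m <- msupp G | all (fun i => m i == k i) s)
     (G@_m * \prod_i (v i)%:C%C ^+ m i) *: 'X^(m j).
  have q0 : q = 0.
    apply: poly_natS_eq0 => n; rewrite /q horner_sum.
    rewrite -[RHS](IH (fun i => if i == j then n.+1%:R * v i else v i)); last first.
      by move=> i; case: eqP => _ //; rewrite mulr_gt0.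
    apply: eq_bigr => m _; rewrite hornerZ hornerXn -mulrA; congr (_ * _).
    rewrite (bigD1 j) //= [RHS](bigD1 j) //= eqxx rmorphM exprMn rmorph_nat.
    rewrite mulrC mulrA; congr (_ * _); apply: eq_bigr => i /negPf -> //.
  have := congr1 (fun q : {poly _} => q`_(k j)) q0.
  rewrite coef0 /q coef_sum => qk; rewrite big_mkcondl -[RHS]qk; apply: eq_bigr => m _.
  by rewrite coefZ coefXn eq_sym; case: eqP => _; rewrite ?mulr1 ?mulr0.
have := step (enum 'I_d) (fun=> 1) (fun=> ltr01).
have allE m : all (fun i => m i == k i) (enum 'I_d) = (m == k).
  apply/allP/eqP => [h|-> //]; apply/mnmP => i; apply/eqP/h; exact: mem_enum.
rewrite (eq_bigl _ _ allE).
have [kG|/memN_msupp_eq0 //] := boolP (k \in msupp G).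
rewrite -big_filter filter_pred1_uniq ?msupp_uniq // big_seq1.
by under eq_bigr do rewrite expr1n; rewrite big1_eq mulr1.
Qed.

(** The size bound depends on [p] alone and not on the line, which makes the comparison of values
    along lines uniform in [zeta]. *)
Lemma line_poly p (a b : 'I_d -> R[i]) :
  exists2 q : {poly R[i]}, (size q <= (msize p).+1)%N &
    forall w, q.[w] = p.@[fun i => a i + w * b i].
Proof.
exists (\sum_(m <- msupp p) p@_m *: \prod_i ((a i)%:P + b i *: 'X) ^+ m i); last first.
  move=> w; rewrite horner_sum mevalE; apply: eq_bigr => m _.
  rewrite hornerZ horner_prod; congr (_ * _); apply: eq_bigr => i _.
  by rewrite horner_exp hornerD hornerC hornerZ hornerX mulrC.
apply: leq_trans (size_sum _ _ _) _; rewrite big_seq; apply/bigmax_leqP_seq => m _ mp.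
apply: leq_trans (size_scale_leq _ _) _; apply: leq_trans (size_poly_prod_leq _ _) _.
have sz i : (size (((a i)%:P + b i *: 'X) ^+ m i) <= (m i).+1)%N.
  apply: leq_trans (size_poly_exp_leq _ _) _; rewrite ltnS.
  suff h : ((size ((a i)%:P + b i *: 'X)%R).-1 <= 1)%N.
    by rewrite -[leqRHS]mul1n leq_mul2r h orbT.
  rewrite -subn1 leq_subLR; apply: leq_trans (size_polyD _ _) _.
  rewrite geq_max size_polyC (leq_trans (leq_b1 _)) //=.
  by apply: leq_trans (size_scale_leq _ _) _; rewrite size_polyX.
rewrite leq_subLR; apply: (@leq_trans (\sum_(i < d) (m i).+1).+1).
  by rewrite ltnS leq_sum.
under eq_bigr do rewrite -addn1.
rewrite big_split /= sum1_card -mdegE addnC addnS ltnS leq_add2l.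
by rewrite ltnW // msize_mdeg_lt.
Qed.

End HomogeneousParts.

(** * Estimates in the regions [AR c] *)

Section NonTangentialRegion.
Variables (R : realType) (d : nat) (i1 : 'I_d).
Implicit Types (p q G L : {mpoly R[i][d]}) (zeta : 'I_d -> R[i]) (c : R).

Lemma meval_shift p zeta : (shift p).@[zeta] = p.@[u_minus zeta].
Proof.
rewrite /shift comp_mpoly_meval; apply: meval_eq => i.
by rewrite tnth_mktuple mevalB meval1 mevalXU.
Qed.

Lemma mem_DsetP zeta x :
  reflect (exists i, x = cabs (zeta i) \/ x = complex.Re (zeta i)) (x \in Dset zeta).
Proof.
rewrite mem_cat; apply: (iffP orP) => [[] /imageP[i _ ->]|[i []] ->].
- by exists i; left.
- by exists i; right.
- by left; apply/imageP; exists i.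
- by right; apply/imageP; exists i.
Qed.

Lemma AR_cabs_gt0 c zeta i : AR c zeta -> 0 < cabs (zeta i).
Proof. by move=> [/(_ i) hi _]; apply: lt_le_trans hi (Re_le_cabs _). Qed.

Lemma AR_cabs_le c zeta i j : AR c zeta -> cabs (zeta i) <= c * cabs (zeta j).
Proof.
move=> H; have [_ /(_ (cabs (zeta i)) (cabs (zeta j)))] := H.
have mem k : cabs (zeta k) \in Dset zeta by apply/mem_DsetP; exists k; left.
move=> /(_ (mem i) (mem j)) /andP[_].
by rewrite ler_pdivrMr ?(AR_cabs_gt0 _ H).
Qed.

Lemma AR_cabs_le_Re c zeta i j : AR c zeta -> cabs (zeta j) <= c * complex.Re (zeta i).
Proof.
move=> [pos /(_ (cabs (zeta j)) (complex.Re (zeta i)))].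
have mj : cabs (zeta j) \in Dset zeta by apply/mem_DsetP; exists j; left.
have mi : complex.Re (zeta i) \in Dset zeta by apply/mem_DsetP; exists i; right.
move=> /(_ mj mi) /andP[_].
by rewrite ler_pdivrMr // pos.
Qed.

(** Ratios of coordinates of [t v] do not depend on [t]. The sum [S] dominates every ratio together
    with its inverse, which gives both bounds in [AR]. *)
Lemma AR_posreal_ray (v : 'I_d -> R) : (forall i, 0 < v i) ->
  exists2 c, 1 < c & forall t : R, 0 < t -> AR c (fun i => t%:C%C * (v i)%:C%C).
Proof.
move=> v0; pose S := \sum_i \sum_j v i / v j.
have vv i j : 0 <= v i / v j by rewrite divr_ge0 ?ltW.
have Sij i j : v i / v j <= S.
  rewrite /S (bigD1 i) //= (bigD1 j) //= -addrA lerDl addr_ge0 //.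
    exact: sumr_ge0.
  by apply: sumr_ge0 => k _; apply: sumr_ge0.
have S0 : 0 < S by apply: lt_le_trans (Sij i1 i1); rewrite divr_gt0.
exists (1 + S); first by rewrite ltrDl.
move=> t t0; split=> [i|x y].
  by rewrite -rmorphM /= mulr_gt0.
have inD w : w \in Dset (fun i => t%:C%C * (v i)%:C%C) -> exists i, w = t * v i.
  move=> /mem_DsetP[i [] ->]; exists i.
    by rewrite cabs_realM.
  by rewrite -rmorphM.
move=> /inD[i ->] /inD[j ->].
have -> : t * v i / (t * v j) = v i / v j.
  by rewrite -mulf_div divff ?mul1r // gt_eqF.
rewrite (le_trans (Sij i j)) ?lerDr // andbT.
rewrite -[leRHS]invrK lef_pV2 ?posrE ?invr_gt0 ?divr_gt0 ?addr_gt0 //.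
by rewrite invf_div (le_trans (Sij j i)) // lerDr.
Qed.

(** On the ray through a positive [v] the hypothesis is a one-variable little-o estimate, so
    [hpart j G] vanishes at [v]. *)
Lemma hpart_eq0_of_littleo G n :
    (forall c, 1 < c -> forall eps : R, 0 < eps -> exists2 delta : R, 0 < delta &
      forall zeta, AR c zeta -> (forall i, cabs (zeta i) < delta) ->
        cabs G.@[zeta] <= eps * cabs (zeta i1) ^+ n) ->
  forall j, (j <= n)%N -> hpart j G = 0.
Proof.
move=> ho j jn; apply: mpoly_eq0_of_posreal => v v0.
rewrite -coef_ray_poly; apply: horner_littleo_coef_eq0 jn => eps eps0.
have [c c1 ARc] := AR_posreal_ray v0.
have vn : 0 < v i1 ^+ n by rewrite exprn_gt0.
(* On the ray [|zeta_i1| = t v_i1]; the factor [v i1 ^+ n] is absorbed in advance. *)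
have [del del0 hdel] := ho c c1 (eps / v i1 ^+ n) (divr_gt0 eps0 vn).
have S0 : 0 < 1 + \sum_i v i by rewrite ltr_wpDr // sumr_ge0 // => i _; rewrite ltW.
have vS i : v i < 1 + \sum_i v i.
  rewrite (bigD1 i) //= addrCA ltrDl ltr_wpDr // sumr_ge0 // => k _; exact: ltW.
exists (del / (1 + \sum_i v i)); first by rewrite divr_gt0.
move=> t /andP[t0]; rewrite ltr_pdivlMr // => td.
rewrite horner_ray_poly; apply: le_trans (hdel _ (ARc t t0) _) _ => [i|].
  rewrite cabs_realM //; apply: lt_trans td.
  by rewrite ltr_pM2l.
rewrite cabs_realM //.
by rewrite exprMn mulrCA divfK ?gt_eqF // mulrC.
Qed.

(** All coordinates have modulus at most [c |zeta_i1|], which is at most 1 once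
    [|zeta_i1| < 1/c]. *)
Lemma AR_meval_le G n c : 1 < c -> (forall j, (j < n)%N -> hpart j G = 0) ->
  exists2 C : R, 0 < C & exists2 delta : R, 0 < delta &
    forall zeta, AR c zeta -> (forall i, cabs (zeta i) < delta) ->
      cabs G.@[zeta] <= C * cabs (zeta i1) ^+ n.
Proof.
move=> c1 /meval_le_of_hpart_eq0[C C0 hC]; have c0 : 0 < c by apply: lt_trans c1.
exists (C * c ^+ n); first by rewrite mulr_gt0 ?exprn_gt0.
exists c^-1; first by rewrite invr_gt0.
move=> zeta H small; rewrite -mulrA -exprMn; apply: hC => [|i]; last exact: AR_cabs_le.
apply/andP; split; first by rewrite mulr_ge0 ?cabs_ge0 ?ltW.
by rewrite mulrC -ler_pdivlMr // mul1r ltW.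
Qed.

(** Since [Re z >= r/c], the perturbation [w] leaves [Re (z + w) >= r/(2c)], while [|z + w| <= 2cr].
    Then [4 c^3 r < 1] gives [|z + w|^2 < r/c <= 2 Re (z + w)]. *)
Lemma in_polydisk_near_AR c (r : R) (y z w : R[i]) : 1 < c -> 0 < r ->
    cabs z <= c * r -> r <= c * complex.Re z -> cabs w <= r / (2 * c) ->
    y = z + w -> 4 * c ^+ 3 * r < 1 ->
  cabs (1 - y) < 1.
Proof.
move=> c1 r0 zr rz wr -> small; apply: cabs_1B_lt1.
have c0 : 0 < c by apply: lt_trans c1.
have w1 : cabs w <= c * r.
  apply: le_trans wr _; rewrite mulrC ler_pM2r // invf_ple ?posrE ?mulr_gt0 //.
  apply: (@le_trans _ _ 1); last lra.
  by rewrite invf_le1 // ltW.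
have z1 : r / c <= complex.Re z by rewrite ler_pdivrMr // mulrC.
have hRe : r / (2 * c) <= complex.Re (z + w).
  rewrite ReD; have := Re_ge_opp_cabs w.
  have e : r / (2 * c) = r / c / 2 by rewrite invfM mulrA mulrAC.
  rewrite e in wr *; lra.
have hN : cabs (z + w) <= 2 * c * r.
  by apply: le_trans (cabsD _ _) _; rewrite -mulrA mulrDl mul1r lerD.
have hN2 : cabs (z + w) ^+ 2 <= (2 * c * r) ^+ 2.
  by rewrite lerXn2r ?nnegrE ?cabs_ge0 // !mulr_ge0 ?ltW.
apply: le_lt_trans hN2 _; apply: lt_le_trans (_ : r / c <= _).
  rewrite ltr_pdivlMr //.
  have -> : (2 * c * r) ^+ 2 * c = 4 * c ^+ 3 * r * r by ring.
  by rewrite -[ltRHS]mul1r ltr_pM2r.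
apply: le_trans (_ : 2 * (r / (2 * c)) <= _); last by rewrite ler_pM2l.
by rewrite invfM mulrCA mulVKf ?pnatr_eq0.
Qed.

(* A zero-free polynomial of bounded degree on the line from zeta to r v has
   comparable values at both ends, and p(u - r v) is of size r^M. *)
Lemma AR_meval_ge p M c : 1 < c -> (forall z, in_polydisk z -> p.@[z] != 0) ->
    vanishes_to_order p M ->
  exists2 A : R, 0 < A & exists2 delta : R, 0 < delta &
    forall zeta, AR c zeta -> (forall i, cabs (zeta i) < delta) ->
      A * cabs (zeta i1) ^+ M <= cabs p.@[u_minus zeta].
Proof.
move=> c1 pnz [PM Plt]; have c0 : 0 < c by apply: lt_trans c1.
have [v [v0 Pv]] : exists v : 'I_d -> R, (forall i, 0 < v i) /\
    (hpart M (shift p)).@[fun i => (v i)%:C%C] != 0.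
  apply: boolp.contrapT => H; move/eqP: PM; apply; apply: mpoly_eq0_of_posreal => v v0.
  by apply/eqP/negPn/negP => hv; apply: H; exists v.
set a := cabs (hpart M (shift p)).@[fun i => (v i)%:C%C].
have a0 : 0 < a by rewrite cabs_gt0.
pose K := 1 + \sum_i v i.
have K0 : 0 < K by rewrite ltr_wpDr // sumr_ge0 // => i _; rewrite ltW.
have vK i : v i <= K.
  rewrite /K (bigD1 i) //= addrCA lerDl addr_ge0 // sumr_ge0 // => k _; exact: ltW.
(* Each coordinate of [r v - zeta] has modulus at most [(K + c) r], so a parameter below [rho] moves
   it by at most [r / (2c)], the tolerance of [in_polydisk_near_AR]. *)
pose rho := (2 * c * (K + c))^-1.
have Kc0 : 0 < K + c by apply: addr_gt0.
have rho0 : 0 < rho by rewrite /rho invr_gt0 mulr_gt0 // mulr_gt0 // ltr0n.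
pose E := shift p - hpart M (shift p).
have E0 j : (j < M.+1)%N -> hpart j E = 0.
  rewrite ltnS leq_eqVlt hpartB hpart_hpart => /orP[/eqP ->|jM].
    by rewrite eqxx subrr.
  by rewrite (ltn_eqF jM) subr0 Plt.
have [C C0 hC] := meval_le_of_hpart_eq0 E0.
pose B := (1 + rho^-1) ^+ msize p.
have B0 : 0 < B.
  by apply: exprn_gt0; apply: (addr_gt0 ltr01); rewrite (invr_gt0 rho).
(* The tail [E] costs at most half of [a r^M], and the passage from [r v] to [zeta] costs the factor
   [B]. *)
exists (a / 2 / B); first by rewrite !divr_gt0.
have CK0 : 0 < C * K ^+ M.+1 by rewrite mulr_gt0 ?exprn_gt0.
(* The first bound keeps the disk around [zeta] in the polydisk, the second gives [K r <= 1], and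
   the third makes the tail at [r v] at most [(a / 2) r^M]. *)
exists (Num.min (Num.min (4 * c ^+ 3)^-1 K^-1) (a / (2 * (C * K ^+ M.+1)))).
  rewrite !lt_min !invr_gt0 K0 andbT; apply/andP; split.
    by rewrite mulr_gt0 ?exprn_gt0.
  by apply: (divr_gt0 a0); apply: mulr_gt0 CK0.
move=> zeta H small; set r := cabs (zeta i1).
have r0 : 0 < r by apply: AR_cabs_gt0 H.
have := small i1; rewrite !lt_min -/r => /andP[/andP[r1 r2] r3].
have r1' : 4 * c ^+ 3 * r < 1.
  by move: r1; rewrite -[X in _ < X]div1r ltr_pdivlMr ?mulr_gt0 ?exprn_gt0 // mulrC.
have r2' : K * r <= 1.
  by move: r2; rewrite -[X in _ < X]div1r ltr_pdivlMr // mulrC => /ltW.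
(* The parameter 0 corresponds to [u - zeta] and the parameter 1 to [u - r v]. *)
have [q szq qE] := line_poly p (u_minus zeta) (fun i => zeta i - r%:C%C * (v i)%:C%C).
have q0 : q.[0] = p.@[u_minus zeta].
  by rewrite qE; apply: meval_eq => i; rewrite mul0r addr0.
have q1 : q.[1] = (shift p).@[fun i => r%:C%C * (v i)%:C%C].
  by rewrite qE meval_shift; apply: meval_eq => i; rewrite /u_minus; ring.
have qn w : cabs w < rho -> q.[w] != 0.
  move=> wr; rewrite qE; apply: pnz => i.
  have -> : u_minus zeta i + w * (zeta i - r%:C%C * (v i)%:C%C) =
    1 - (zeta i + w * (r%:C%C * (v i)%:C%C - zeta i)) by rewrite /u_minus; ring.
  apply: (in_polydisk_near_AR c1 r0 _ _ _ erefl r1').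
  - exact: AR_cabs_le.
  - exact: AR_cabs_le_Re.
  - have bi : cabs (r%:C%C * (v i)%:C%C - zeta i) <= (K + c) * r.
      apply: le_trans (cabsB _ _) _; rewrite mulrDl lerD ?AR_cabs_le //.
      by rewrite cabs_realM // mulrC ler_pM2r.
    rewrite cabsM; apply: le_trans (ler_pM (cabs_ge0 _) (cabs_ge0 _) (ltW wr) bi) _.
    rewrite /rho invfM -mulrA [X in _ * X]mulrA mulVf ?mul1r 1?mulrC //.
    by rewrite gt_eqF.
have := horner1_le_horner0 rho0 szq qn; rewrite q0 q1 -/B => hle.
have hE : cabs E.@[fun i => r%:C%C * (v i)%:C%C] <= C * (K * r) ^+ M.+1.
  apply: hC => [|i]; first by rewrite r2' mulr_ge0 ?ltW.
  by rewrite cabs_realM // mulrC ler_pM2r.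
have hP : a * r ^+ M = cabs (hpart M (shift p)).@[fun i => r%:C%C * (v i)%:C%C].
  by rewrite meval_hpart_scale cabsM cabsX cabs_real ?(ltW r0) // mulrC.
have hPE : a * r ^+ M <= cabs (shift p).@[fun i => r%:C%C * (v i)%:C%C] +
    cabs E.@[fun i => r%:C%C * (v i)%:C%C].
  by rewrite hP -(subKr (shift p) (hpart M (shift p))) mevalB cabsB.
have hE2 : C * (K * r) ^+ M.+1 <= a / 2 * r ^+ M.
  rewrite exprMn mulrA [r ^+ M.+1]exprS mulrA ler_pM2r ?exprn_gt0 //.
  move: r3; rewrite invfM mulrA ltr_pdivlMr // mulrC => /ltW //.
rewrite mulrAC ler_pdivrMr //.
apply: le_trans hle; move: hPE hE hE2; lra.
Qed.

(** Multiplying the error by the denominator, of exact size [r^M] in [AR c], trades [o(r^k)] for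
    [o(r^(M+k))]. Conversely, the vanishing parts make the residual [O(r^(M+k+1))]. *)
Lemma nt_approx_fracP p q L M k : (forall z, in_polydisk z -> p.@[z] != 0) ->
    vanishes_to_order p M ->
  nt_approx i1 (fun z => q.@[z] / p.@[z]) L k <->
  (forall j, (j <= M + k)%N -> hpart j (shift q - L * shift p) = 0).
Proof.
move=> pnz van; have [_ Plt] := van.
have err c : 1 < c -> exists2 delta : R, 0 < delta &
  forall zeta, AR c zeta -> (forall i, cabs (zeta i) < delta) ->
    0 < cabs p.@[u_minus zeta] /\
    cabs (shift q - L * shift p).@[zeta] =
      cabs (q.@[u_minus zeta] / p.@[u_minus zeta] - L.@[zeta]) * cabs p.@[u_minus zeta].
  move=> c1; have [A A0 [del del0 hA]] := AR_meval_ge c1 pnz van.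
  exists del => // zeta H small; have p0 : 0 < cabs p.@[u_minus zeta].
    apply: lt_le_trans (hA zeta H small).
    by rewrite mulr_gt0 ?exprn_gt0 // (AR_cabs_gt0 _ H).
  split=> //; rewrite -cabsM mulrBl divfK -?cabs_gt0 //.
  rewrite -(meval_shift q) -(meval_shift p).
  by move: (shift q) (shift p) => q' p'; rewrite mevalB mevalM.
split=> [happ|hG].
  apply: hpart_eq0_of_littleo => c c1 eps eps0.
  have [del0 d00 herr] := err c c1.
  have [C C0 [del1 d10 hC]] := AR_meval_le c1 Plt.
  have [del2 d20 hf] := happ c c1 (eps / C) (divr_gt0 eps0 C0).
  exists (Num.min (Num.min del0 del1) del2); first by rewrite !lt_min d00 d10.
  move=> zeta H small.
  have s0 i : cabs (zeta i) < del0 by move: (small i); rewrite !lt_min => /andP[/andP[]].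
  have s1 i : cabs (zeta i) < del1 by move: (small i); rewrite !lt_min => /andP[/andP[]].
  have s2 i : cabs (zeta i) < del2 by move: (small i); rewrite !lt_min => /andP[].
  have [_ ->] := herr zeta H s0.
  apply: le_trans (ler_pM (cabs_ge0 _) (cabs_ge0 _) (hf zeta H s2) _) _.
    by rewrite -(meval_shift p); apply: hC.
  by rewrite mulrACA divfK ?gt_eqF // -exprD addnC.
move=> c c1 eps eps0.
have [del0 d00 herr] := err c c1.
have [A A0 [del1 d10 hA]] := AR_meval_ge c1 pnz van.
have [C C0 [del2 d20 hC]] := @AR_meval_le (shift q - L * shift p) (M + k).+1 c c1 hG.
(* The bound [eps * A / C] turns [C r^(M+k+1)] into at most [eps A r^(M+k)], and [A r^M] is the
   lower bound for the denominator. *)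
exists (Num.min (Num.min del0 del1) (Num.min del2 (eps * A / C))).
  by rewrite !lt_min d00 d10 d20 divr_gt0 ?mulr_gt0.
move=> zeta H small.
have s0 i : cabs (zeta i) < del0 by move: (small i); rewrite !lt_min => /andP[/andP[]].
have s1 i : cabs (zeta i) < del1 by move: (small i); rewrite !lt_min => /andP[/andP[]].
have s2 i : cabs (zeta i) < del2 by move: (small i); rewrite !lt_min => /andP[_ /andP[]].
have : cabs (zeta i1) < eps * A / C.
  by move: (small i1); rewrite !lt_min => /andP[_ /andP[]].
rewrite ltr_pdivlMr // => s3.
have [p0 e] := herr zeta H s0; have := hC zeta H s2; rewrite e => hle.
rewrite -(ler_pM2r p0); apply: le_trans hle _.
have r0 : 0 < cabs (zeta i1) by apply: AR_cabs_gt0 H.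
apply: le_trans (ler_wpM2l _ (hA zeta H s1)); last by rewrite mulr_ge0 ?exprn_ge0 ?ltW.
rewrite mulrACA -exprD [(k + M)%N]addnC exprS mulrA ler_pM2r ?exprn_gt0 //.
by rewrite mulrC ltW.
Qed.

End NonTangentialRegion.

(** * Division degree by degree and the recursion for the [F j] *)

Section FormalDivision.
Variables (R : realType) (d : nat).
Implicit Types (A B L : {mpoly R[i][d]}) (F : nat -> {mpoly R[i][d]}) (nu : R[i]).

Lemma hpartM_homog a b A B : hpart a A = A -> hpart (a + b) (A * B) = A * hpart b B.
Proof.
move=> hA; rewrite hpartM (bigD1 (inord a)) //= big1 ?addr0 => [|i ia].
  by rewrite inordK ?ltnS ?leq_addr // hA addKn.
rewrite -{1}hA hpart_hpart ifF ?mul0r //; apply: contraNF ia => /eqP ia.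
by apply/eqP/val_inj; rewrite /= inordK ?ia // ltnS leq_addr.
Qed.

Lemma hpart_homog_quotient a b A B : A != 0 -> hpart a A = A ->
  hpart (a + b) (A * B) = A * B -> hpart b B = B.
Proof. by move=> A0 hA; rewrite hpartM_homog // => /(mulfI A0). Qed.

Lemma hpartM_lt M A L j : (forall i, (i < M)%N -> hpart i A = 0) -> (j < M)%N ->
  hpart j (L * A) = 0.
Proof.
move=> A0 jM; rewrite hpartM big1 // => i _; rewrite A0 ?mulr0 //.
by rewrite (leq_ltn_trans (leq_subr _ _)).
Qed.

(** The summands with [i > j] contain a part of [A] of degree below [M]. *)
Lemma hpartM_ge M A L j : (forall i, (i < M)%N -> hpart i A = 0) ->
  hpart (M + j) (L * A) = \sum_(0 <= i < j.+1) hpart i L * hpart (M + j - i) A.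
Proof.
move=> A0; rewrite hpartM -(big_mkord xpredT (fun i => hpart i L * hpart (M + j - i) A)).
rewrite (big_cat_nat (n := j.+1)) //=; last by rewrite ltnS leq_addl.
rewrite -[RHS]addr0; congr (_ + _); rewrite big_nat big1 // => i /andP[ji iMj].
rewrite A0 ?mulr0 //; rewrite ltnS in iMj; rewrite -(ltn_add2r i) subnK //.
by rewrite ltn_add2l.
Qed.

(** Below degree [M] the residual vanishes trivially, and in degree [M] by the two assumptions
    involving [nu]. In degree [M + j], isolating the summands [i = 0] and [i = j] of the product
    gives the recursion. *)
Lemma hpart_residual_eq0P M k nu A B L :
    (forall j, (j < M)%N -> hpart j A = 0) -> (forall j, (j < M)%N -> hpart j B = 0) ->
    hpart M B = nu%:MP * hpart M A -> hpart 0 L = nu%:MP ->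
  (forall j, (j <= M + k)%N -> hpart j (B - L * A) = 0) <->
  (forall j, (1 <= j <= k)%N ->
    hpart M A * hpart j L = hpart (M + j) B - nu%:MP * hpart (M + j) A
      - \sum_(1 <= i < j) hpart i L * hpart (M + j - i) A).
Proof.
move=> A0 B0 BM L0.
have split_sum j : (0 < j)%N -> hpart (M + j) (B - L * A) =
    hpart (M + j) B - nu%:MP * hpart (M + j) A
    - \sum_(1 <= i < j) hpart i L * hpart (M + j - i) A - hpart M A * hpart j L.
  move=> j0; rewrite hpartB (hpartM_ge _ _ A0) big_ltn // big_nat_recr //= L0 subn0 addnK.
  by rewrite [hpart j L * _]mulrC !opprD !addrA.
split=> [h j /andP[j0 jk]|h j jMk].
  apply/esym/eqP; rewrite -subr_eq0 -split_sum // h ?leq_add2l //.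
have [jM|] := ltnP j M; first by rewrite hpartB B0 // (hpartM_lt _ A0) // subrr.
move/subnKC => jE; rewrite -jE leq_add2l in jMk *.
have [->|j0] := posnP (j - M).
  by rewrite addn0 hpartB -{2}[M]addn0 (hpartM_ge _ _ A0) big_nat1 subn0 addn0 L0 BM subrr.
by rewrite split_sum // -h ?subrr // j0.
Qed.

Lemma hpart_sum_homog k F nu i : (forall j, (1 <= j <= k)%N -> hpart j (F j) = F j) ->
  hpart i (nu%:MP + \sum_(1 <= j < k.+1) F j) =
    if i == 0%N then nu%:MP else if (i <= k)%N then F i else 0.
Proof.
move=> hF; rewrite hpartD hpartC hpart_sum.
have hi j : (1 <= j < k.+1)%N -> hpart i (F j) = if i == j then F j else 0.
  by move=> jk; rewrite -(hF j jk) hpart_hpart hF.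
rewrite (eq_big_nat _ _ hi) -big_mkcond /=.
case: eqP => [->|/eqP i0].
  by rewrite big_nat_cond big_pred0 ?addr0 // => j; case: j => // j; rewrite andbF.
rewrite add0r; case: leqP => ik.
  have mi : i \in index_iota 1 k.+1 by rewrite mem_index_iota lt0n i0.
  rewrite -big_filter (eq_filter (a2 := pred1 i)); last by move=> j; rewrite /= eq_sym.
  by rewrite filter_pred1_uniq ?iota_uniq // big_seq1.
rewrite big_nat_cond big_pred0 // => j; case: eqP => [<-|]; rewrite ?andbF //.
by rewrite ltnS (leqNgt i k) ik andbF.
Qed.

Lemma msize_sum_homog k F nu : (forall j, (1 <= j <= k)%N -> hpart j (F j) = F j) ->
  (msize (nu%:MP + \sum_(1 <= j < k.+1) F j) <= k.+1)%N.
Proof.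
move=> hF; set L := _ + _; rewrite msizeE; apply/bigmax_leqP_seq => m mL _.
rewrite ltnS leqNgt; apply/negP => km; have := mcoeff_hpart (mdeg m) L m.
rewrite eqxx hpart_sum_homog // gtn_eqF ?(leq_trans _ km) // leqNgt km /= mcoeff0.
by move/esym/eqP; rewrite mcoeff_eq0 mL.
Qed.

(** The recursion does not prescribe homogeneity. By strong induction its right-hand side is
    homogeneous of degree [M + j], and cancelling the nonzero [Pj p M] leaves degree [j]. *)
Lemma F_seq_homog p M nu k F : Pj p M != 0 -> F_seq_ok p M nu k F ->
  forall j, (1 <= j <= k)%N -> hpart j (F j) = F j.
Proof.
rewrite /F_seq_ok /Pj /Qj; move: (shift p) (shift (ptilde p)) => A B A0 Fok.
elim/ltn_ind => j IH jk.
have hh n (C : {mpoly R[i][d]}) : hpart n (hpart n C) = hpart n C.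
  by rewrite hpart_hpart eqxx.
apply: (hpart_homog_quotient A0 (hh _ _)); rewrite Fok //.
rewrite !hpartB hh hpart_sum; congr (_ - _ - _).
  by have := @hpartM_homog 0 (M + j) nu%:MP (hpart (M + j) A);
    rewrite hpartC hh add0n => ->.
apply: eq_big_nat => i /andP[i1 ij].
have iMj : (i <= M + j)%N by rewrite (leq_trans (ltnW ij)) ?leq_addl.
rewrite -{1}(subnKC iMj) hpartM_homog ?hh //; apply: IH => //.
by rewrite i1 (leq_trans (ltnW ij)) //; case/andP: jk.
Qed.

End FormalDivision.

(** * The characterization of non-tangential regularity *)

Theorem theorem14p8 (R : realType) (d : nat) (hd : (0 < d)%N)
    (p : {mpoly R[i][d]}) (M : nat) (nu : R[i]) :
  (forall z, in_polydisk z -> p.@[z] != 0) ->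
  vanishes_to_order p M ->
  nt_value (fratio p) nu ->
  (nt_Ck (Ordinal hd) (fratio p) 1 <->
     exists q : {mpoly R[i][d]}, Qj p M.+1 - nu%:MP * Pj p M.+1 = Pj p M * q) /\
  (forall k : nat,
     (nt_Ck (Ordinal hd) (fratio p) k <-> exists F, F_seq_ok p M nu k F) /\
     (forall F, F_seq_ok p M nu k F ->
        nt_approx (Ordinal hd) (fratio p) (nu%:MP + \sum_(1 <= j < k.+1) F j) k)).
Proof.
move=> pnz van ntv; have [PM Plt] := van.
have approxP L k := @nt_approx_fracP R d (Ordinal hd) p (ptilde p) L M k pnz van.
(* Having the value [nu] means being approximated to order 0 by the constant [nu]. *)
have hnu j : (j <= M)%N -> Qj p j = nu%:MP * Pj p j.
  move=> jM; apply/eqP; rewrite -subr_eq0; apply/eqP.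
  have /approxP/(_ j) : nt_approx (Ordinal hd) (fratio p) nu%:MP 0.
    move=> c c1 eps eps0; have [del del0 hdel] := ntv c c1 eps eps0.
    by exists del => // zeta H small; rewrite expr0 mulr1 mevalC ltW // hdel.
  rewrite addn0 => /(_ jM); rewrite hpartB; have := @hpartM_homog _ _ 0 j nu%:MP (shift p).
  by rewrite hpartC add0n => ->.
have Qlt j : (j < M)%N -> Qj p j = 0.
  by move=> jM; rewrite hnu ?(ltnW jM) // /Pj Plt // mulr0.
have Ck_of_F k F : F_seq_ok p M nu k F ->
    nt_approx (Ordinal hd) (fratio p) (nu%:MP + \sum_(1 <= j < k.+1) F j) k.
  move=> Fok; have hF := F_seq_homog PM Fok; set L := _ + _.
  have LF i : (1 <= i <= k)%N -> hpart i L = F i.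
    by case/andP=> i0 ik; rewrite hpart_sum_homog // gtn_eqF // ik.
  apply/approxP/(hpart_residual_eq0P _ Plt Qlt (hnu M (leqnn M))).
    by rewrite hpart_sum_homog.
  move=> j jk; rewrite LF //; apply: etrans (Fok j jk) _; congr (_ - _).
  apply: eq_big_nat => i /andP[i0 ij]; rewrite LF // i0.
  by rewrite (leq_trans (ltnW ij)) //; case/andP: jk.
have CkP k : nt_Ck (Ordinal hd) (fratio p) k <-> exists F, F_seq_ok p M nu k F.
  split=> [[L _ /approxP res]|[F Fok]]; last first.
    exists (nu%:MP + \sum_(1 <= j < k.+1) F j); last exact: Ck_of_F.
    exact/msize_sum_homog/F_seq_homog/Fok.
  (* The residual in degree [M] reads [Q_M - L_0 P_M = 0], while [Q_M = nu P_M]; cancel [P_M]. *)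
  have L0 : hpart 0 L = nu%:MP.
    apply: (mulIf PM); apply: etrans (hnu M (leqnn M)); apply/esym/eqP.
    have := res M (leq_addr _ _); rewrite hpartB -{2}[M]addn0 (hpartM_ge _ _ Plt).
    by rewrite big_nat1 subn0 addn0 => /eqP; rewrite subr_eq0.
  exists (fun i => hpart i L) => j jk.
  exact: (hpart_residual_eq0P k Plt Qlt (hnu M (leqnn M)) L0).1.
split; last by move=> k; split; [exact: CkP | exact: Ck_of_F].
(* For [k = 1] the sum in the recursion is empty and only [F 1] is constrained, so a constant
   sequence serves as witness. *)
apply: iff_trans (CkP 1) _; split=> [[F /(_ 1%N isT)]|[q Pq]].
  by rewrite big_geq // subr0 addn1 => e; exists (F 1%N).
exists (fun=> q) => j /andP[j1 j1']; have -> : j = 1%N by apply/eqP; rewrite eqn_leq j1 j1'.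
by rewrite big_geq // subr0 addn1.
Qed.
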